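(* Let $X$ be a real Banach space, let $Y, Z_1$ be closed linear subspaces of $X$, and let $Z_2=Z_1\cap Y$. Suppose that $Z_2$ is locally constrained with respect to $Z_1$ via $Y$. If $Z_1$ is an $M$-ideal in $X$, then $Z_2$ is an $M$-ideal in $Y$. Likewise, if $Z_1$ is a semi $M$-ideal in $X$, then $Z_2$ is a semi $M$-ideal in $Y$.
   Context: All Banach spaces are real; ''subspace'' means closed linear subspace. Locally constrained: for subspaces $Z_1,Y$ of $X$ and $Z_2=Z_1\cap Y$, $Z_2$ is locally constrained with respect to $Z_1$ via $Y$ if for every $z\in Z_1$ there are linear projections $P:\operatorname{span}\{z,Z_2\}\to Z_2$ (onto $Z_2$) and $Q:\operatorname{span}\{z,Y\}\to Y$ (onto $Y$) of norm one such that $Pz=Qz$. $M$-ideal: a subspace $J$ of $X$ is an $M$-ideal in $X$ if $X^*=J^\perp\oplus_{\ell_1}W$ for some subspace $W$ of $X^*$, i.e. $X^*=J^\perp\oplus W$ and $\|u+w\|=\|u\|+\|w\|$ for $u\in J^\perp$, $w\in W$. Semi $M$-ideal: a subspace $J$ of $X$ is a semi $M$-ideal in $X$ if $J^\perp$ is a semi $L$-summand of $X^*$, i.e. $J^\perp$ is the range of a (not necessarily linear) map $\Pi:X^*\to X^*$ satisfying $\Pi(\lambda x^*+\Pi y^* )=\lambda\Pi x^*+\Pi y^*$ and $\|x^*\|=\|\Pi x^*\|+\|x^*-\Pi x^*\|$ for all $x^*,y^*\in X^*$ and all scalars $\lambda$. *)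

(* Defs.v *)
From HB Require Import structures.
From mathcomp Require Import all_boot all_order all_algebra.
From mathcomp Require Import all_classical all_reals.
From mathcomp Require Import topology normedtype sequences.

Set Implicit Arguments.
Unset Strict Implicit.
Unset Printing Implicit Defensive.

Import Order.TTheory GRing.Theory Num.Theory.
Import numFieldNormedType.Exports.

Local Open Scope classical_set_scope.
Local Open Scope ring_scope.

(* Linear subspaces are terms of type [submodClosed V]; topological closedness
   is stated separately, as [closed [set` Y]], because the span of a vector and
   a closed subspace is used as a domain before it is known to be closed. *)

Section linear_subspaces.
Context {R : realType} {V : lmodType R}.

Definition capS_pred (S T : submodClosed V) : {pred V} := [predI S & T].

Lemma capS_submod_closed (S T : submodClosed V) : submod_closed (capS_pred S T).
Proof.
split; first by rewrite inE /= !rpred0.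
by move=> a u v /andP[uS uT] /andP[vS vT]; rewrite inE /= !rpredD ?rpredZ.
Qed.

HB.instance Definition _ (S T : submodClosed V) :=
  GRing.isSubmodClosed.Build R V (capS_pred S T) (capS_submod_closed S T).

Definition capS (S T : submodClosed V) : submodClosed V := capS_pred S T.

Definition linspan_pred (A : set V) : {pred V} :=
  mem [set v | forall S : submodClosed V, A `<=` [set` S] -> v \in S].

Lemma linspan_submod_closed (A : set V) : submod_closed (linspan_pred A).
Proof.
split; first by rewrite inE /= => S _; rewrite rpred0.
move=> a u v; rewrite !inE /= => uA vA S AS.
by rewrite rpredD ?rpredZ ?uA ?vA.
Qed.

HB.instance Definition _ (A : set V) :=
  GRing.isSubmodClosed.Build R V (linspan_pred A) (linspan_submod_closed A).

Definition linspan (A : set V) : submodClosed V := linspan_pred A.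

Record subsp (S : submodClosed V) :=
  Subsp { subsp_val : V ; subsp_valP : subsp_val \in S }.

HB.instance Definition _ (S : submodClosed V) := [isSub for @subsp_val S].
HB.instance Definition _ (S : submodClosed V) := [Choice of subsp S by <:].
HB.instance Definition _ (S : submodClosed V) :=
  [SubChoice_isSubLmodule of subsp S by <:].

Lemma subsp_val_is_linear (S : submodClosed V) : linear (@subsp_val S).
Proof. by []. Qed.

HB.instance Definition _ (S : submodClosed V) :=
  GRing.isLinear.Build R (subsp S) V *:%R (@subsp_val S)
    (@subsp_val_is_linear S).

(* {y in Y | y in S}, as a linear subspace of the normed space Y. *)
Definition inside_pred (Y S : submodClosed V) : {pred subsp Y} :=
  [pred y : subsp Y | subsp_val y \in S].
Arguments inside_pred : clear implicits.

Lemma inside_submod_closed (Y S : submodClosed V) :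
  submod_closed (inside_pred Y S).
Proof.
split; first by rewrite inE /= rpred0.
move=> a u v; rewrite !inE /= => uS vS.
by rewrite rpredD ?rpredZ.
Qed.

HB.instance Definition _ (Y S : submodClosed V) :=
  GRing.isSubmodClosed.Build R (subsp Y) (inside_pred Y S)
    (inside_submod_closed Y S).

Definition inside (Y S : submodClosed V) : submodClosed (subsp Y) :=
  inside_pred Y S.

End linear_subspaces.

Section subsp_norm.
Context {R : realType} {V : normedModType R}.
Variable S : submodClosed V.

Let norm_subsp (x : subsp S) : R := `|subsp_val x|.

Let ler_norm_subspD x y : norm_subsp (x + y) <= norm_subsp x + norm_subsp y.
Proof. by rewrite /norm_subsp linearD /= ler_normD. Qed.

Let norm_subspZ (a : R) x : norm_subsp (a *: x) = `|a| * norm_subsp x.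
Proof. by rewrite /norm_subsp linearZ /= normrZ. Qed.

Let norm_subsp_eq0 x : norm_subsp x = 0 -> x = 0.
Proof. by move=> /normr0_eq0 x0; apply: val_inj; exact: x0. Qed.

HB.instance Definition _ := @Lmodule_isNormed.Build R (subsp S) norm_subsp
  ler_norm_subspD norm_subspZ norm_subsp_eq0.

End subsp_norm.

(* The operator norm of f if f is linear and bounded; [sup] is 0 on unbounded
   sets, so an unbounded linear map gets the value 0. *)
Definition opnorm {R : realType} {V W : normedModType R} (f : V -> W) : R :=
  sup [set `|f x| | x in [set x : V | `|x| <= 1]].

Section dual.
Context {R : realType}.
Variable V : normedModType R.

Definition dual_pred : {pred V -> R^o} :=
  mem [set f : V -> R^o | linear f /\ continuous f].

Lemma dual_submod_closed : submod_closed dual_pred.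
Proof.
split.
  rewrite inE /=; split; last exact: cst_continuous.
  by move=> a u v; rewrite scaler0 addr0.
move=> a f g; rewrite !inE /= => -[lf cf] [lg cg]; split.
  move=> b u v; rewrite !fctE lf lg !scalerDr !scalerA (mulrC a b).
  by rewrite addrACA.
move=> x; apply: cvgD; last exact: cg.
by apply: cvgZl_tmp; exact: cf.
Qed.

HB.instance Definition _ :=
  GRing.isSubmodClosed.Build R (V -> R^o) dual_pred dual_submod_closed.

Record dual := Dual { dual_fun :> V -> R^o ; dual_funP : dual_fun \in dual_pred }.

HB.instance Definition _ := [isSub for dual_fun].
HB.instance Definition _ := [Choice of dual by <:].
HB.instance Definition _ := [SubChoice_isSubLmodule of dual by <:].

Lemma dual_linear (f : dual) : linear f.
Proof. by have := dual_funP f; rewrite inE => -[]. Qed.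

Lemma dual_continuous (f : dual) : continuous f.
Proof. by have := dual_funP f; rewrite inE => -[]. Qed.

HB.instance Definition _ (f : dual) :=
  GRing.isLinear.Build R V R^o *:%R (dual_fun f) (dual_linear f).

Lemma dual_has_sup (f : dual) :
  has_sup [set `|f x| | x in [set x : V | `|x| <= 1]].
Proof.
split; first by exists `|f 0|, 0 => //=; rewrite normr0.
have /linear_bounded_continuous/linear_boundedP fb := @dual_continuous f.
near (pinfty_nbhs R) => r.
have fr : forall x, `|f x| <= r * `|x| by near: r.
have r0 : 0 <= r by near: r; exact: nbhs_pinfty_ge.
exists r => _ [x /= x1 <-]; apply: le_trans (fr x) _.
by rewrite ler_piMr.
Unshelve. all: by end_near. Qed.

Lemma opnorm_ge0 (f : dual) : 0 <= opnorm f.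
Proof.
have [_ ub] := dual_has_sup f.
apply: le_trans (normr_ge0 (f 0)) _.
by apply: ub_le_sup => //; exists 0 => //=; rewrite normr0.
Qed.

Lemma ler_opnorm (f : dual) (x : V) : `|f x| <= opnorm f * `|x|.
Proof.
have [->|x0] := eqVneq x 0; first by rewrite linear0 !normr0 mulr0.
have nx : 0 < `|x| by rewrite normr_gt0.
have [_ ub] := dual_has_sup f.
rewrite -ler_pdivrMr //.
have -> : `|f x| / `|x| = `|f (`|x|^-1 *: x)|.
  by rewrite linearZ normrZ normfV normr_id mulrC.
apply: ub_le_sup => //; exists (`|x|^-1 *: x) => //=.
by rewrite normrZ normfV normr_id mulVf // gt_eqF.
Qed.

Lemma opnorm_le (f : dual) (r : R) : 0 <= r ->
  (forall x, `|f x| <= r * `|x|) -> opnorm f <= r.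
Proof.
move=> r0 fr; apply: ge_sup; first by case: (dual_has_sup f).
by move=> _ [x /= x1 <-]; apply: le_trans (fr x) _; rewrite ler_piMr.
Qed.

Let ler_dual_normD (f g : dual) : opnorm (f + g : dual) <= opnorm f + opnorm g.
Proof.
apply: opnorm_le => [|x]; first by apply: addr_ge0; exact: opnorm_ge0.
rewrite mulrDl; apply: le_trans (ler_normD _ _) _.
by apply: lerD; exact: ler_opnorm.
Qed.

Let dual_normZ_le (a : R) (f : dual) : opnorm (a *: f : dual) <= `|a| * opnorm f.
Proof.
apply: opnorm_le => [|x]; first by apply: mulr_ge0 => //; exact: opnorm_ge0.
have -> : (a *: f) x = a *: f x by [].
by rewrite normrZ -mulrA ler_wpM2l // ler_opnorm.
Qed.

Let dual_normZ (a : R) (f : dual) : opnorm (a *: f : dual) = `|a| * opnorm f.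
Proof.
apply/eqP; rewrite eq_le dual_normZ_le andTb.
have [->|a0] := eqVneq a 0.
  by rewrite normr0 mul0r; exact: opnorm_ge0.
have -> : opnorm f = opnorm (a^-1 *: (a *: f) : dual).
  by rewrite scalerA mulVf // scale1r.
rewrite -ler_pdivlMl ?normr_gt0 //; apply: le_trans (dual_normZ_le _ _) _.
by rewrite normfV.
Qed.

Let dual_norm_eq0 (f : dual) : opnorm f = 0 -> f = 0.
Proof.
move=> f0; apply: val_inj; apply/funext => x /=.
by apply/normr0_eq0/le_anti; rewrite normr_ge0 andbT -(mul0r `|x|) -f0 ler_opnorm.
Qed.

HB.instance Definition _ := @Lmodule_isNormed.Build R dual
  (fun f => opnorm f) ler_dual_normD dual_normZ dual_norm_eq0.

End dual.

Section M_ideals.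
Context {R : realType}.

Definition annihilator_pred {V : normedModType R} (J : submodClosed V) :
  {pred dual V} := mem [set f : dual V | forall x, x \in J -> f x = 0].

Lemma annihilator_submod_closed {V : normedModType R} (J : submodClosed V) :
  submod_closed (annihilator_pred J).
Proof.
split; first by rewrite inE.
move=> a f g; rewrite !inE /= => fJ gJ x xJ.
by rewrite !fctE fJ // gJ // scaler0 addr0.
Qed.

HB.instance Definition _ (V : normedModType R) (J : submodClosed V) :=
  GRing.isSubmodClosed.Build R (dual V) (annihilator_pred J)
    (annihilator_submod_closed J).

Definition annihilator {V : normedModType R} (J : submodClosed V) :
  submodClosed (dual V) := annihilator_pred J.

Definition l1_sum {E : normedModType R} (U W : submodClosed E) : Prop :=
  [/\ forall e : E, exists u w, [/\ u \in U, w \in W & e = u + w],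
      forall e : E, e \in U -> e \in W -> e = 0 &
      forall u w : E, u \in U -> w \in W -> `|u + w| = `|u| + `|w| ].

Definition M_ideal {V : normedModType R} (J : submodClosed V) : Prop :=
  closed [set` J] /\
  exists W : submodClosed (dual V),
    closed [set` W] /\ l1_sum (annihilator J) W.

Definition semi_L_summand {E : normedModType R} (S : submodClosed E) : Prop :=
  exists Pi : E -> E,
    [/\ range Pi = [set` S],
        forall (a : R) (x y : E), Pi (a *: x + Pi y) = a *: Pi x + Pi y &
        forall x : E, `|x| = `|Pi x| + `|x - Pi x| ].

Definition semi_M_ideal {V : normedModType R} (J : submodClosed V) : Prop :=
  closed [set` J] /\ semi_L_summand (annihilator J).

(* P is a projection of D onto S, where S is a subspace of D. *)
Definition projection_onto {V : normedModType R} (D S : submodClosed V)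
    (P : {linear subsp D -> subsp S}) : Prop :=
  forall (x : subsp D) (s : subsp S), subsp_val x = subsp_val s -> P x = s.

Definition locally_constrained {V : normedModType R} (Z2 Z1 Y : submodClosed V)
    : Prop :=
  forall z, z \in Z1 ->
    exists (P : {linear subsp (linspan (z |` [set` Z2])) -> subsp Z2})
           (Q : {linear subsp (linspan (z |` [set` Y])) -> subsp Y}),
      [/\ projection_onto P, projection_onto Q,
          opnorm P = 1, opnorm Q = 1 &
          forall zP zQ, subsp_val zP = z -> subsp_val zQ = z ->
            subsp_val (P zP) = subsp_val (Q zQ) ].

End M_ideals.

(* Main.v *)
(* M-ideals and semi M-ideals are recognized by intersecting balls: J is an
   M-ideal (a semi M-ideal) of V as soon as, for x in the unit ball of V and
   y_i in the unit ball of J with i < 3 (i < 2), every e > 0 admits z in J with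
   |x + y_i - z| <= 1 + e for all i; conversely both kinds of ideals have these
   ball properties. Sufficiency: Hahn-Banach gives V^* = J^perp + J^#, where J^#
   consists of the norm-preserving extensions of functionals on J; two balls
   make this decomposition additive for the norm, and three balls make J^#
   closed under addition. Necessity: if the balls have no common point in J,
   separating in the n-fold sup-norm product yields functionals with sum in
   J^perp that contradict the norm additivity of the decomposition. The ball
   property passes from Z1 to Z2 by applying Q to x + y_i - w with w in Z1,
   because Q w = P w is in Z2. *)

From HB Require Import structures.
Require Import Defs.
From mathcomp Require Import all_boot all_order all_algebra.
From mathcomp Require Import all_classical all_reals.
From mathcomp Require Import topology normedtype.
From mathcomp Require Import ring lra.

Set Implicit Arguments.
Unset Strict Implicit.
Unset Printing Implicit Defensive.

Import Order.TTheory GRing.Theory Num.Theory.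
Import numFieldNormedType.Exports.

Local Open Scope classical_set_scope.
Local Open Scope ring_scope.

(** * Hahn-Banach theorem under a sublinear bound, with a constraint on a cone *)

Section hahn_banach.
Context {R : realType} {V : lmodType R}.
Implicit Types (p q : V -> R) (K : set (V * R)).

Definition sublinear p : Prop :=
  (forall u v, p (u + v) <= p u + p v) /\
  (forall a u, 0 <= a -> p (a *: u) <= a * p u).

Lemma sublinear0 p : sublinear p -> p 0 = 0.
Proof.
move=> [pD pZ]; apply/le_anti/andP; split.
  by have := pZ 0 0 (lexx _); rewrite scale0r mul0r.
by have := pD 0 0; rewrite addr0; lra.
Qed.

Lemma sublinear_ge_opp p v : sublinear p -> - p (- v) <= p v.
Proof.
by move=> sp; have := sp.1 v (- v); rewrite subrr sublinear0 //; lra.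
Qed.

Definition convex_cone K : Prop :=
  [/\ K (0, 0), forall k l, K k -> K l -> K (k.1 + l.1, k.2 + l.2) &
      forall a k, 0 <= a -> K k -> K (a *: k.1, a * k.2)].

(** For a convex cone [K] lying below a sublinear [p], this is the largest sublinear [q <= p] with
    [q (- k.1) <= - k.2] on [K]. A linear functional below it is therefore at least [k.2] at
    [k.1]. *)
Definition cone_inf p K v := inf [set p (v + k.1) - k.2 | k in K].

Section cone_inf.
Context (p : V -> R) (K : set (V * R)).
Hypotheses (sp : sublinear p) (cK : convex_cone K).
Hypothesis pK : forall k, K k -> k.2 <= p k.1.

Lemma cone_inf_le_at k v : K k -> cone_inf p K v <= p (v + k.1) - k.2.
Proof.
move=> Kk; apply: ge_inf; last by exists k.
(* The set must be bounded below for [inf] to be meaningful; this bound comes from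
   [l.2 <= p l.1 <= p (v + l.1) + p (- v)]. *)
exists (- p (- v)) => _ [l Kl <-].
have := sp.1 (v + l.1) (- v); rewrite addrAC subrr add0r.
by have := pK Kl; lra.
Qed.

Lemma cone_inf_le v : cone_inf p K v <= p v.
Proof.
by have [K0 _ _] := cK; have := cone_inf_le_at v K0; rewrite /= addr0 subr0.
Qed.

Lemma le_cone_inf r v :
  (forall k, K k -> r <= p (v + k.1) - k.2) -> r <= cone_inf p K v.
Proof.
have [K0 _ _] := cK.
move=> rK; apply: lb_le_inf; first by exists (p (v + 0) - 0), (0, 0).
by move=> _ [k Kk <-]; exact: rK.
Qed.

Lemma cone_inf_sublinear : sublinear (cone_inf p K).
Proof.
have [K0 KD KZ] := cK; split=> [u v|a u a0].
  rewrite -lerBlDr; apply: le_cone_inf => k Kk.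
  suff: cone_inf p K (u + v) - (p (u + k.1) - k.2) <= cone_inf p K v by lra.
  apply: le_cone_inf => l Kl; have := cone_inf_le_at (u + v) (KD _ _ Kk Kl).
  by have := sp.1 (u + k.1) (v + l.1); rewrite /= addrACA; lra.
have [->|an0] := eqVneq a 0.
  by rewrite scale0r mul0r -(sublinear0 sp) cone_inf_le.
have agt0 : 0 < a by rewrite lt_def an0.
rewrite -ler_pdivrMl //; apply: le_cone_inf => k Kk; rewrite ler_pdivrMl //.
have := cone_inf_le_at (a *: u) (KZ _ _ a0 Kk).
by have := sp.2 a (u + k.1) a0; rewrite /= scalerDr; lra.
Qed.

Lemma cone_inf_opp k : K k -> cone_inf p K (- k.1) <= - k.2.
Proof.
move=> Kk; have := cone_inf_le_at (- k.1) Kk.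
by rewrite addNr sublinear0 //; lra.
Qed.

End cone_inf.

(** The pointwise infimum works. Given [r] and [s] in the chain, the smaller of the two shows that
    the infimum at [u + v] is at most [r u + s v], so subadditivity survives. *)
Lemma chain_inf_sublinear p (C : set (V -> R)) : C !=set0 ->
  (forall q, C q -> sublinear q /\ forall v, q v <= p v) ->
  (forall q1 q2, C q1 -> C q2 ->
     (forall v, q1 v <= q2 v) \/ (forall v, q2 v <= q1 v)) ->
  exists q, [/\ sublinear q, forall v, q v <= p v &
    forall q', C q' -> forall v, q v <= q' v].
Proof.
move=> [q0 Cq0] Cp tC.
pose q v := inf [set r v | r in C].
have qle r v : C r -> q v <= r v.
  move=> Cr; apply: ge_inf; last by exists r.
  exists (- p (- v)) => _ [s /Cp[ss sp] <-].
  by have := sublinear_ge_opp v ss; have := sp (- v); lra.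
have leq x v : (forall r, C r -> x <= r v) -> x <= q v.
  move=> xr; apply: lb_le_inf; first by exists (q0 v), q0.
  by move=> _ [r Cr <-]; exact: xr.
exists q; split; last by move=> r Cr v; exact: qle.
- split=> [u v|a u a0].
    suff: q (u + v) - q v <= q u by lra.
    apply: (leq _ u) => r Cr; suff: q (u + v) - r u <= q v by lra.
    apply: (leq _ v) => s Cs.
    have [sr _] := Cp _ Cr; have [ss _] := Cp _ Cs.
    have [rs|rs] := tC _ _ Cr Cs.
      by have := qle r (u + v) Cr; have := sr.1 u v; have := rs v; lra.
    by have := qle s (u + v) Cs; have := ss.1 u v; have := rs u; lra.
  have [->|an0] := eqVneq a 0.
    rewrite scale0r mul0r; have [s0 _] := Cp _ Cq0.
    by rewrite -(sublinear0 s0) qle.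
  have agt0 : 0 < a by rewrite lt_def an0.
  rewrite -ler_pdivrMl //; apply: (leq _ u) => r Cr; rewrite ler_pdivrMl //.
  by apply: le_trans (qle _ _ Cr) _; exact: (Cp _ Cr).1.2.
- by move=> v; apply: le_trans (qle _ _ Cq0) _; exact: (Cp _ Cq0).2.
Qed.

Lemma exists_minimal_sublinear p : sublinear p ->
  exists q, [/\ sublinear q, forall v, q v <= p v &
    forall q', sublinear q' -> (forall v, q' v <= q v) -> q' = q].
Proof.
move=> sp.
pose T := {q : V -> R | sublinear q /\ forall v, q v <= p v}.
(* The order is reversed because [Zorn] produces maximal elements. *)
pose geT (q q' : T) := `[< forall v, sval q' v <= sval q v >].
have [||||[q [sq qp]] qmin] := @Zorn T geT.
- by move=> q; apply/asboolP.
- move=> q r s /asboolP rq /asboolP qs; apply/asboolP => v.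
  exact: le_trans (qs v) (rq v).
- move=> [q qP] [r rP] /asboolP /= qr /asboolP /= rq.
  have e : q = r.
    by apply/funext => v; apply: le_anti; rewrite qr rq.
  by subst r; congr exist; exact: Prop_irrelevance.
- move=> A tA; have [[a Aa]|A0] := pselect (A !=set0); last first.
    exists (exist _ p (conj sp (fun v => lexx _))) => s As.
    by exfalso; apply: A0; exists s.
  have [||_ _ [x Ax <-] [y Ay <-]|q [sq qp qA]] :=
    @chain_inf_sublinear p [set sval q | q in A].
  + by exists (sval a), a.
  + by move=> _ [x _ <-]; exact: svalP x.
  + by have [/asboolP|/asboolP] := tA _ _ Ax Ay; [right|left].
  + by exists (exist _ q (conj sq qp)) => s As; apply/asboolP => v;
      apply: qA; exists s.
- exists q; split=> // q' sq' q'q.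
  have q'p v : q' v <= p v by exact: le_trans (q'q v) (qp v).
  have := qmin (exist _ q' (conj sq' q'p)).
  by move=> /(_ (asboolT q'q)) /(congr1 sval).
Qed.

(* If q is minimal then subtracting q along any ray [t |-> t *: x] does not
   decrease it, which is additivity. *)
Lemma minimal_sublinear_linear q : sublinear q ->
  (forall q', sublinear q' -> (forall v, q' v <= q v) -> q' = q) ->
  linear (q : V -> R^o).
Proof.
move=> sq qmin.
have qD u v : q (u + v) = q u + q v.
  apply/le_anti/andP; split; first exact: sq.1.
  pose K := [set k : V * R | exists2 t, 0 <= t & k = (t *: v, t * q v)].
  have cK : convex_cone K.
    split=> [|_ _ [s s0 ->] [t t0 ->]|a _ a0 [t t0 ->]] /=.
    - by exists 0; rewrite // scale0r mul0r.
    - by exists (s + t); rewrite ?addr_ge0 // scalerDl mulrDl.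
    - by exists (a * t); rewrite ?mulr_ge0 // scalerA mulrA.
  have qK k : K k -> k.2 <= q k.1.
    move=> [t t0 ->] /=; have [->|tn0] := eqVneq t 0.
      by rewrite mul0r scale0r sublinear0.
    have tgt0 : 0 < t by rewrite lt_def tn0.
    have := sq.2 t^-1 (t *: v); rewrite invr_ge0 => /(_ t0).
    by rewrite scalerA mulVf // scale1r ler_pdivlMl.
  have Kv : K (v, q v) by exists 1; rewrite // scale1r mul1r.
  (* Minimality identifies [cone_inf q K] with [q], which turns this bound into
     [q u <= q (u + v) - q v]. *)
  have := cone_inf_le_at sq qK u Kv.
  rewrite (qmin (cone_inf q K)) /=; first by lra.
    exact: cone_inf_sublinear.
  exact: cone_inf_le.
have qN v : q (- v) = - q v.
  by have := qD v (- v); rewrite subrr sublinear0 //; lra.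
have qZ a v : 0 <= a -> q (a *: v) = a * q v.
  move=> a0; apply/le_anti; rewrite sq.2 //=.
  by have := sq.2 a (- v) a0; rewrite scalerN !qN; lra.
move=> a u v; rewrite qD; congr (_ + _).
have [/qZ //|a0] := leP 0 a.
have := qZ (- a) u; rewrite oppr_ge0 scaleNr qN mulNr.
by move=> /(_ (ltW a0))/oppr_inj.
Qed.

(* K constrains g from below: pairs (w, r) and (- w, - r) in K force g w = r,
   so this form gives extension and separation at once. *)
Theorem hahn_banach_cone p K : sublinear p -> convex_cone K ->
  (forall k, K k -> k.2 <= p k.1) ->
  exists g : {linear V -> R^o},
    (forall v, g v <= p v) /\ (forall k, K k -> k.2 <= g k.1).
Proof.
move=> sp cK pK.
have [q [sq qp qmin]] := exists_minimal_sublinear (cone_inf_sublinear sp cK pK).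
have lq := minimal_sublinear_linear sq qmin.
pose gM := GRing.isLinear.Build R V R^o *:%R q lq.
pose g : {linear V -> R^o} := HB.pack q gM.
exists g; split=> [v|k Kk].
  by apply: le_trans (qp v) _; exact: cone_inf_le.
have := le_trans (qp _) (cone_inf_opp sp pK Kk).
by rewrite -[q _]/(g (- k.1)) linearN lerN2.
Qed.

End hahn_banach.

(** * Norm estimates in the dual, and functionals normed by a subspace *)

Section dual_norm.
Context {R : realType} {V : normedModType R}.
Implicit Types (f g h : dual V) (J : submodClosed V).

Lemma dual_norm_ge f x : f x <= `|f| * `|x|.
Proof. by apply: le_trans (ler_norm _) _; exact: ler_opnorm. Qed.

Lemma dual_norm_le f c : 0 <= c -> (forall x, f x <= c * `|x|) -> `|f| <= c.
Proof.
move=> c0 fc; apply: opnorm_le => // x; rewrite ler_norml fc andbT.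
by have := fc (- x); rewrite linearN normrN; lra.
Qed.

Lemma dualDE f g x : (f + g) x = f x + g x.
Proof. by []. Qed.

Lemma dualNE f x : (- f) x = - f x.
Proof. by []. Qed.

Lemma dual_sumE n (f : 'I_n -> dual V) x : (\sum_i f i) x = \sum_i f i x.
Proof.
by elim/big_rec2: _ => [|i y g _ <-] //; rewrite dualDE.
Qed.

Lemma exists_dual (f : {linear V -> R^o}) (c : R) :
  (forall x, f x <= c * `|x|) -> exists h : dual V, h =1 f.
Proof.
move=> fc.
have cf : continuous f.
  apply/linear_bounded_continuous/linear_boundedP.
  near=> r; move=> /= x; apply: (@le_trans _ _ (c * `|x|)).
    by rewrite ler_norml fc andbT lerNl -linearN -normrN fc.
  by apply: ler_wpM2r => //; near: r; exact: nbhs_pinfty_ge (num_real c).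
have fd : (f : V -> R^o) \in dual_pred (V:=V).
  by rewrite inE; split => //; exact: linearP.
by exists (Dual fd).
Unshelve. all: by end_near. Qed.

Lemma dual_le_of_ball J f c : 0 <= c ->
  (forall x, x \in J -> `|x| <= 1 -> f x <= c) ->
  forall x, x \in J -> f x <= c * `|x|.
Proof.
move=> c0 fc x xJ; have [->|x0] := eqVneq x 0.
  by rewrite linear0 normr0 mulr0.
have nx : 0 < `|x| by rewrite normr_gt0.
have := fc (`|x|^-1 *: x) (rpredZ _ xJ).
rewrite normrZ normfV normr_id mulVf ?gt_eqF // => /(_ (lexx _)).
by rewrite linearZ /= [_ *: _]mulrC ler_pdivrMr.
Qed.

Lemma dual_norm_adherent f e : 0 < e ->
  exists2 x, `|x| <= 1 & `|f| - e <= f x.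
Proof.
move=> e0; have [_ [x /= x1 <-] lt_f] := sup_adherent e0 (dual_has_sup f).
have [fx|fx] := leP 0 (f x).
  by exists x => //; rewrite ltW // -[f x](ger0_norm fx).
by exists (- x); rewrite ?normrN // linearN /= ltW // -(ltr0_norm fx).
Qed.

(* The set J^# of functionals with the same norm as their restriction to J. *)
Definition normed_by J : set (dual V) :=
  [set f : dual V | forall c, 0 <= c ->
     (forall x, x \in J -> f x <= c * `|x|) -> `|f| <= c].

Lemma normed_by_adherent J f e : normed_by J f -> 0 < e ->
  exists x, [/\ x \in J, `|x| <= 1 & `|f| - e <= f x].
Proof.
move=> fJ e0; apply: contrapT => H.
have lt_f x : x \in J -> `|x| <= 1 -> f x < `|f| - e.
  by move=> xJ x1; rewrite ltNge; apply/negP => le_f; apply: H; exists x.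
(* The strict bound at the point 0 of [J] makes this constant admissible in [normed_by]. *)
have c0 : 0 < `|f| - e.
  by rewrite -(linear0 f) lt_f ?rpred0 // normr0.
suff : `|f| <= `|f| - e by lra.
apply: fJ => [|x]; first exact: ltW.
by apply: dual_le_of_ball => [|y yJ y1]; rewrite ltW ?lt_f.
Qed.

End dual_norm.

(** * Common centers of balls, by separation in a sup-norm product *)

Section ball_property.
Context {R : realType} {V : normedModType R}.
Implicit Types (f g h : dual V) (J : submodClosed V).

Lemma annihilatorP J f :
  reflect (forall x, x \in J -> f x = 0) (f \in annihilator J).
Proof. by apply: (iffP idP); rewrite inE. Qed.

Lemma submodN J x : x \in J -> - x \in J.
Proof. by move=> xJ; rewrite -scaleN1r rpredZ. Qed.

Definition maxnorm n (w : 'I_n -> V) : R := \big[Num.max/0]_i `|w i|.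

Lemma maxnorm_le n (w : 'I_n -> V) c : 0 <= c -> (forall i, `|w i| <= c) ->
  maxnorm w <= c.
Proof. by move=> c0 wc; apply: bigmax_le. Qed.

Lemma le_maxnorm n (w : 'I_n -> V) i : `|w i| <= maxnorm w.
Proof. exact: le_bigmax. Qed.

Lemma maxnorm_ge0 n (w : 'I_n -> V) : 0 <= maxnorm w.
Proof. exact: bigmax_ge_id. Qed.

Lemma maxnorm_sublinear n : sublinear (@maxnorm n).
Proof.
split=> [u v|a u a0]; apply: maxnorm_le => [|i].
- by rewrite addr_ge0 ?maxnorm_ge0.
- by apply: le_trans (ler_normD _ _) _; rewrite lerD ?le_maxnorm.
- by rewrite mulr_ge0 ?maxnorm_ge0.
- by rewrite normrZ ger0_norm // ler_wpM2l ?le_maxnorm.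
Qed.

(* The family [f] represents a functional on the sup-norm product of n copies
   of V; it vanishes on the diagonal copy of J exactly when the sum of the f i
   annihilates J. *)
Lemma exists_common_center n J (v : 'I_n -> V) e : 0 < e ->
  (forall f : 'I_n -> dual V, (\sum_i f i) \in annihilator J ->
     \sum_i f i (v i) <= \sum_i `|f i|) ->
  exists2 z, z \in J & forall i, `|v i - z| <= 1 + e.
Proof.
move=> e0 fv; apply: contrapT => H.
(* The elements with [t = 1] demand at least [1 + e] on every [v - z]; those with [t = 0] force
   vanishing on the diagonal copy of [J]. The absence of a center is what keeps [K] below
   [maxnorm]. *)
pose K := [set k : ('I_n -> V) * R | exists t z,
  [/\ 0 <= t, z \in J & k = ((fun i => t *: v i - z), t * (1 + e))]].
have cK : convex_cone K.
  split=> [|_ _ [s [y [s0 yJ ->]]] [t [z [t0 zJ ->]]]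
         |a _ a0 [t [z [t0 zJ ->]]]] /=.
  - exists 0, 0; split; rewrite ?rpred0 ?mul0r //; congr pair.
    by apply/funext => i; rewrite scale0r subr0.
  - exists (s + t), (y + z); split; rewrite ?addr_ge0 ?rpredD ?mulrDl //.
    by congr pair; apply/funext => i; rewrite fctE scalerDl opprD addrACA.
  - exists (a * t), (a *: z); split; rewrite ?mulr_ge0 ?rpredZ ?mulrA //.
    by congr pair; apply/funext => i; rewrite fctE scalerBr scalerA.
have pK k : K k -> k.2 <= maxnorm k.1.
  move=> [t [z [t0 zJ ->]]] /=; have [->|tn0] := eqVneq t 0.
    by rewrite mul0r maxnorm_ge0.
  have tgt0 : 0 < t by rewrite lt_def tn0.
  have [//|lt_t] := leP (t * (1 + e)) (maxnorm (fun i => t *: v i - z)).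
  exfalso; apply: H; exists (t^-1 *: z); rewrite ?rpredZ // => i.
  rewrite -(ler_pM2l tgt0) (le_trans _ (ltW lt_t)) //.
  rewrite -[X in X * _](ger0_norm t0) -normrZ scalerBr scalerA divff // scale1r.
  exact: (le_maxnorm (fun i => t *: v i - z)).
have [g [gp gK]] := hahn_banach_cone (maxnorm_sublinear n) cK pK.
pose d i x : 'I_n -> V := fun j => if j == i then x else 0.
have exF i : exists f, f =1 (fun x => g (d i x)).
  have lgd : linear (fun x => g (d i x) : R^o).
    move=> a x y; rewrite -linearP; congr (g _); apply/funext => j.
    by rewrite !fctE /d; case: eqP; rewrite ?scaler0 ?addr0.
  pose gdM := GRing.isLinear.Build R V R^o *:%R _ lgd.
  pose gd : {linear V -> R^o} := HB.pack (fun x => g (d i x) : R^o) gdM.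
  apply: (@exists_dual _ _ gd 1) => x; rewrite mul1r.
  apply: le_trans (gp _) _; apply: maxnorm_le => // j; rewrite /d.
  by case: eqP; rewrite ?normr0.
have [F FE] := choice exF.
have gE w : g w = \sum_i F i (w i).
  rewrite [in LHS](_ : w = \sum_i d i (w i)); last first.
    apply/funext => j; rewrite fct_sumE (bigD1 j) //= big1 => [|i ij].
      by rewrite addr0 /d eqxx.
    by rewrite /d eq_sym (negbTE ij).
  by rewrite linear_sum; apply: eq_bigr => i _; rewrite FE.
have Fann : (\sum_i F i) \in annihilator J.
  apply/annihilatorP => z zJ; rewrite dual_sumE -(gE (fun=> z)).
  have g0 y : y \in J -> 0 <= g (fun=> y).
    move=> yJ; apply: (gK ((fun=> y), 0)); exists 0, (- y).
    split; rewrite ?submodN ?mul0r //; congr pair; apply/funext => i.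
    by rewrite scale0r opprK add0r.
  apply/le_anti; rewrite g0 // andbT -oppr_ge0 -linearN; apply: g0.
  exact: submodN.
have := gK (fun i => 1 *: v i - 0, 1 * (1 + e)).
have /[swap]/[apply] /= : K ((fun i => 1 *: v i - 0), 1 * (1 + e)).
  by exists 1, 0; rewrite rpred0.
rewrite gE mul1r; under eq_bigr do rewrite scale1r subr0.
move=> /le_trans/(_ (fv F Fann)).
(* Dividing by [n.+1] keeps the total loss of [n] terms strictly below [e] and covers [n = 0]. *)
have d0 : 0 < e / n.+1%:R by rewrite divr_gt0.
have exw i : exists x, `|x| <= 1 /\ `|F i| - e / n.+1%:R <= F i x.
  by have [x x1 Fx] := dual_norm_adherent (F i) d0; exists x.
have [w wP] := choice exw.
have : \sum_i F i (w i) <= 1.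
  by rewrite -gE (le_trans (gp _)) // maxnorm_le // => i; have [] := wP i.
have : \sum_i (`|F i| - e / n.+1%:R) <= \sum_i F i (w i).
  by apply: ler_sum => i _; have [] := wP i.
rewrite sumrB sumr_const card_ord -[_ *+ n]mulr_natr -mulrA.
have : n.+1%:R^-1 * n%:R < 1 :> R by rewrite ltr_pdivrMl // mulr1 ltr_nat.
rewrite -(ltr_pM2l e0) mulr1 => h1 h2 h3 h4.
move: h1 h4 (le_trans h2 h3).
by move: (e * (_ * _)) (\sum_i `|F i|) => s S; lra.
Qed.

End ball_property.

(** * Ball properties and their equivalence with (semi) M-ideals *)

Section M_ideal_ball.
Context {R : realType} {V : normedModType R}.
Implicit Types (f g h : dual V) (J : submodClosed V).

Definition ball_property n J : Prop :=
  forall (x : V) (y : 'I_n -> V) e, `|x| <= 1 ->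
    (forall i, y i \in J) -> (forall i, `|y i| <= 1) -> 0 < e ->
  exists2 z, z \in J & forall i, `|x + y i - z| <= 1 + e.

(** Since [g i] kills [y i] and the remainders [f i - g i] sum to zero, [x] is tested only by [g i]
    and [y i] only by [f i - g i]. Norm additivity then bounds the total by the sum of the norms of
    the [f i]. *)
Lemma splitting_ball_property n J :
  (forall f : 'I_n -> dual V, \sum_i f i \in annihilator J ->
    exists g : 'I_n -> dual V,
      [/\ forall i, g i \in annihilator J,
          forall i, `|f i| = `|g i| + `|f i - g i| &
          \sum_i (f i - g i) = 0]) ->
  ball_property n J.
Proof.
move=> fJ x y e x1 yJ y1 e0; apply: exists_common_center => // f /fJ.
move=> [g [gJ fg sfg]].
have -> : \sum_i f i (x + y i) = \sum_i (g i x + (f i - g i) (y i)).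
  transitivity (\sum_i (g i x + (f i - g i) (y i)) + (\sum_i (f i - g i)) x).
    rewrite dual_sumE -big_split; apply: eq_bigr => i _.
    have /annihilatorP/(_ _ (yJ i)) giy := gJ i.
    by rewrite !dualDE !dualNE linearD giy subr0 /= [RHS]addrC addrA subrK.
  by rewrite sfg [X in _ + X](_ : _ = 0) ?addr0.
apply: ler_sum => i _; rewrite fg; apply: lerD.
  by apply: le_trans (dual_norm_ge _ _) _; rewrite ler_piMr.
by apply: le_trans (dual_norm_ge _ _) _; rewrite ler_piMr.
Qed.

Lemma M_ideal_ball_property n J : M_ideal J -> ball_property n J.
Proof.
move=> [_ [W [_ [dec JW nrm]]]]; apply: splitting_ball_property => f fJ.
have /choice[g gP] : forall i, exists g, g \in annihilator J /\ f i - g \in W.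
  move=> i; have [u [w [uJ wW ->]]] := dec (f i).
  by exists u; rewrite addrAC subrr add0r.
exists g; split=> [i|i|]; first by have [] := gP i.
  by have [gJ fgW] := gP i; rewrite -nrm // addrC subrK.
(* The sum of the [W]-components is also a difference of two annihilating functionals, so it lies in
   the trivial intersection. *)
apply: JW; last by apply: rpred_sum => i _; have [] := gP i.
rewrite sumrB rpredD // submodN //.
by apply: rpred_sum => i _; have [] := gP i.
Qed.

Lemma semi_M_ideal_ball_property J : semi_M_ideal J -> ball_property 2 J.
Proof.
move=> [_ [Pi [rPi PiD Pin]]]; apply: splitting_ball_property => f fJ.
have PiJ h : Pi h \in annihilator J.
  by have := imageT Pi h; rewrite rPi.
exists (Pi \o f); split=> [i|i|] //=.
have : [set` annihilator J] (\sum_i f i) by [].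
rewrite -rPi => -[v _].
rewrite !big_ord_recl !big_ord0 !addr0 /= => Piv.
(* The second functional thus has the form on which [Pi] is additive, and the two remainders are
   opposite. *)
have -> : f (lift ord0 ord0) = (-1) *: f ord0 + Pi v.
  by rewrite Piv scaleN1r addKr.
by rewrite PiD !scaleN1r opprD opprK [X in _ + X]addrACA subrr addr0 addrACA
  subrr addNr addr0.
Qed.

Lemma normed_byZ J a f : normed_by J f -> normed_by J (a *: f).
Proof.
move=> fJ c c0 fc; rewrite normrZ.
have [->|a0] := eqVneq a 0; first by rewrite normr0 mul0r.
have na : 0 < `|a| by rewrite normr_gt0.
rewrite -ler_pdivlMl //; apply: fJ => [|x xJ].
  by rewrite mulr_ge0 // invr_ge0.
rewrite -mulrA ler_pdivlMl //.
have [s0|s0] := ger0P a; first exact: fc.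
have := fc (- x) (submodN xJ); rewrite normrN.
by have -> : (a *: f) (- x) = - a * f x by rewrite mulNr -mulrN -linearN.
Qed.

(** Norm-preserving extension: the cone is the graph of [f] over [J], and the sublinear bound is the
    norm of [f] restricted to [J] times the norm of [V]. *)
Lemma exists_normed_by J f :
  exists2 h, normed_by J h & forall x, x \in J -> h x = f x.
Proof.
pose S := [set f x | x in [set x | x \in J /\ `|x| <= 1]].
have S0 : S 0 by exists 0; rewrite ?linear0 //=; split; rewrite ?rpred0 ?normr0.
have ubS : has_ubound S.
  exists `|f| => _ [x [xJ x1] <-].
  by apply: le_trans (dual_norm_ge _ _) _; rewrite ler_piMr.
pose c := sup S.
have c0 : 0 <= c by exact: ub_le_sup.
have fc x : x \in J -> f x <= c * `|x|.
  by apply: dual_le_of_ball => // y yJ y1; apply: ub_le_sup => //; exists y.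
pose K := [set k : V * R | k.1 \in J /\ k.2 = f k.1].
have [||k [kJ ->]|g [gc gK]] :=
  @hahn_banach_cone _ _ (fun x : V => c * `|x|) K.
- split=> [u v|a u a0]; first by rewrite -mulrDr ler_wpM2l ?ler_normD.
  by rewrite normrZ ger0_norm // mulrCA.
- split=> [|k l [kJ ->] [lJ ->]|a k a0 [kJ ->]] /=; split=> /=.
  + by rewrite rpred0.
  + by rewrite linear0.
  + by rewrite rpredD.
  + by rewrite linearD.
  + by rewrite rpredZ.
  + by rewrite linearZ.
- exact: fc.
have [h hg] := exists_dual gc.
have hf x : x \in J -> h x = f x.
  move=> xJ; rewrite hg; apply/le_anti/andP; split; last first.
    by apply: (gK (x, f x)).
  rewrite -lerN2 -!linearN; apply: (gK (- x, f (- x))); split=> //=.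
  exact: submodN.
exists h => // b b0 hb; apply: (@le_trans _ _ c).
  by apply: dual_norm_le => // x; rewrite hg.
apply: ge_sup; first by exists 0.
move=> _ [x [xJ x1] <-]; rewrite -hf //.
by apply: le_trans (hb x xJ) _; rewrite ler_piMr.
Qed.

Section two_balls.
Variable J : submodClosed V.
Hypothesis ballJ : ball_property 2 J.

(** Let [x] nearly norm [g] and [y] in [J] nearly norm [f]. Adding the values of [f + g] at
    [x + y - z] and of [- f] at [x - y - z] leaves [g x + 2 f y]; the three approximation errors
    give the constant 3. *)
Lemma normD_normed_by f g : normed_by J f -> g \in annihilator J ->
  `|f + g| = `|f| + `|g|.
Proof.
move=> fJ /annihilatorP gJ; apply/le_anti; rewrite ler_normD /=.
suff le_e e : 0 < e -> `|f| + `|g| <= (1 + e) * `|f + g| + e * (3 + `|f|).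
  apply/ler_addgt0Pr => e e0.
  pose c := `|f + g| + 3 + `|f|.
  have c0 : 0 < c by rewrite ltr_pwDl // ltr_wpDl.
  have := le_e (e / c) (divr_gt0 e0 c0).
  suff -> : (1 + e / c) * `|f + g| + e / c * (3 + `|f|) = `|f + g| + e by [].
  by rewrite /c in c0 *; field; rewrite gt_eqF.
move=> e0.
have [x x1 gx] := dual_norm_adherent g e0.
have [y [yJ y1 fy]] := normed_by_adherent fJ e0.
pose s (i : 'I_2) := if i == 0 then y else - y.
have [||z zJ xyz] := ballJ (y := s) x1 _ _ e0.
- by move=> i; rewrite /s; case: eqP => // _; exact: submodN.
- by move=> i; rewrite /s; case: eqP; rewrite ?normrN.
have bound h u : `|u| <= 1 + e -> h u <= (1 + e) * `|h|.
  move=> u1; apply: le_trans (dual_norm_ge _ _) _.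
  by rewrite mulrC ler_wpM2r.
have : f (x + y - z) + g (x + y - z) <= (1 + e) * `|f + g|.
  exact: (bound (f + g) (x + y - z) (xyz 0)).
have : - f (x - y - z) <= (1 + e) * `|f|.
  by rewrite -[`|f|]normrN; exact: (bound (- f) (x - y - z) (xyz 1)).
rewrite !linearB !linearD /= (gJ y yJ) (gJ z zJ) subr0 addr0.
move: gx fy; move: (f x : R) (f y : R) (f z : R) (g x : R) => fx fy fz gx.
by move: `|f + g| `|f| `|g| => a b c; nra.
Qed.

(** Additivity of the norm for [g = f + (g - f)], together with [|g| <= |f|], leaves no room for
    [g - f]. *)
Lemma normed_by_inj f g : normed_by J f -> normed_by J g ->
  (forall x, x \in J -> f x = g x) -> f = g.
Proof.
move=> fJ gJ fg.
have gfJ : g - f \in annihilator J.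
  by apply/annihilatorP => x xJ; rewrite dualDE dualNE fg // subrr.
have := normD_normed_by fJ gfJ; rewrite addrC subrK => nE.
have : `|g| <= `|f|.
  by apply: gJ => // x xJ; rewrite -fg //; exact: dual_norm_ge.
by rewrite nE gerDl normr_le0 subr_eq0 => /eqP.
Qed.

End two_balls.

Lemma ball_property_semi_M_ideal J : closed [set` J] -> ball_property 2 J ->
  semi_M_ideal J.
Proof.
move=> cJ bJ; split=> //.
(* [H f] is the norm-preserving extension of [f] restricted to [J]. Its uniqueness makes [H]
   homogeneous and insensitive to adding annihilating functionals, which gives the required identity
   for [f - H f]. *)
pose H f := s2val (cid2 (exists_normed_by J f)).
have HJ f : normed_by J (H f) by exact: s2valP (cid2 (exists_normed_by J f)).
have HE f x : x \in J -> H f x = f x.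
  exact: s2valP' (cid2 (exists_normed_by J f)) x.
have HI f g : normed_by J g -> (forall x, x \in J -> g x = f x) -> H f = g.
  by move=> gJ gf; apply: (normed_by_inj bJ) => // x xJ; rewrite HE ?gf //.
have subHJ f : f - H f \in annihilator J.
  by apply/annihilatorP => x xJ; rewrite dualDE dualNE HE // subrr.
exists (fun f => f - H f); split=> [|a f g|f].
- apply/seteqP; split=> [_ [f _ <-]|f /annihilatorP fJ] /=; first exact: subHJ.
  exists f => //; rewrite (HI f 0) ?subr0 // => [c c0 _|x xJ].
    by rewrite normr0.
  by rewrite fJ.
- rewrite (HI (a *: f + (g - H g)) (a *: H f)) ?scalerBr;
    first by rewrite addrAC.
    exact: normed_byZ.
  move=> x xJ; have /annihilatorP/(_ x xJ) gx := subHJ g.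
  rewrite dualDE gx addr0.
  by rewrite -[LHS]/(a * H f x) HE.
- by rewrite addrC subKr -(normD_normed_by bJ) // addrC subrK.
Qed.

(** Choose [y i] nearly norming [f i]. The ball bound at [x + y i - z] leaves [f i (x - z)] at most
    [e * (|f i| + 1)], and these values sum to [g x] because [g] kills [z]. *)
Lemma normed_by_sum_eq0 n J (f : 'I_n -> dual V) : ball_property n J ->
  (forall i, normed_by J (f i)) -> \sum_i f i \in annihilator J ->
  \sum_i f i = 0.
Proof.
move=> bJ fJ; set g := \sum_i f i => /annihilatorP gJ.
apply/eqP; rewrite -normr_le0.
suff le_e e : 0 < e -> `|g| <= e * (1 + \sum_i (`|f i| + 1)).
  apply/ler_addgt0Pr => e e0; rewrite add0r.
  have c0 : 0 < 1 + \sum_i (`|f i| + 1).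
    by rewrite ltr_wpDr // sumr_ge0 // => i _; rewrite addr_ge0.
  by have := le_e _ (divr_gt0 e0 c0); rewrite divfK ?gt_eqF.
move=> e0.
have [x x1 gx] := dual_norm_adherent g e0.
have /choice[y yP] i := normed_by_adherent (fJ i) e0.
have [||z zJ xyz] := bJ x y e x1 _ _ e0.
- by move=> i; have [] := yP i.
- by move=> i; have [] := yP i.
rewrite mulrDr mulr1 addrC -lerBlDr; apply: le_trans gx _.
have -> : g x = \sum_i f i (x - z).
  by rewrite -dual_sumE -/g linearB /= (gJ z zJ) subr0.
rewrite mulr_sumr; apply: ler_sum => i _.
have [yJ y1 fy] := yP i.
have : f i (x + y i - z) <= `|f i| * (1 + e).
  by apply: le_trans (dual_norm_ge _ _) _; rewrite ler_wpM2l.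
rewrite !linearB !linearD /=.
move: fy; move: (f i x : R) (f i (y i) : R) (f i z : R) `|f i| => a b c d.
by lra.
Qed.

Lemma ball_propertyS n J : ball_property n.+1 J -> ball_property n J.
Proof.
move=> bJ x y e x1 yJ y1 e0.
(* The additional ball is centered at [x] itself. *)
pose y' i := if unlift ord_max i is Some j then y j else 0.
have [||z zJ xyz] := bJ x y' e x1 _ _ e0.
- by move=> i; rewrite /y'; case: unlift => [j|]; rewrite ?rpred0.
- by move=> i; rewrite /y'; case: unlift => [j|]; rewrite ?normr0.
by exists z => // i; have := xyz (lift ord_max i); rewrite /y' liftK.
Qed.

Lemma normed_by_closed J : closed (normed_by J).
Proof.
move=> f clf c c0 fc; apply/ler_addgt0Pr => e e0.
have [|g [gJ]] := clf (ball f (e / 2)); first by apply: nbhsx_ballx; lra.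
rewrite -ball_normE /= => fg.
suff gc : `|g| <= c + e / 2.
  by have := ler_normD (f - g) g; rewrite subrK; lra.
apply: gJ => [|x xJ]; first by lra.
have := fc x xJ; have := dual_norm_ge (g - f) x.
rewrite dualDE dualNE -[`|g - f|]normrN opprB.
have := ler_wpM2r (normr_ge0 x) (ltW fg).
by rewrite mulrDl; lra.
Qed.

Lemma ball_property_M_ideal J : closed [set` J] -> ball_property 3 J ->
  M_ideal J.
Proof.
move=> cJ b3J; have b2J := ball_propertyS b3J; split=> //.
have decJ f : exists2 h, normed_by J h & f - h \in annihilator J.
  have [h hJ hf] := exists_normed_by J f.
  exists h => //; apply/annihilatorP => x xJ.
  by rewrite dualDE dualNE hf // subrr.
have nJ0 : normed_by J 0 by move=> c c0 _; rewrite normr0.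
have nJD f g : normed_by J f -> normed_by J g -> normed_by J (f + g).
  move=> fJ gJ; have [h hJ fgh] := decJ (f + g).
  (* [f], [g] and [- h] are all normed by [J] and their sum annihilates [J]; its vanishing means
     that [f + g] is the normed functional [h]. *)
  pose F (i : 'I_3) := [tuple f; g; - h]`_i.
  have FE : \sum_i F i = f + g - h.
    by rewrite !big_ord_recl big_ord0 addr0 addrA.
  suff /eqP : f + g - h = 0 by rewrite subr_eq0 => /eqP ->.
  rewrite -FE; apply: (normed_by_sum_eq0 b3J); last by rewrite FE.
  case=> [[|[|[|//]]] ilt]; rewrite /F //=.
  by rewrite -scaleN1r; exact: normed_byZ.
pose W : {pred dual V} := mem (normed_by J).
have WP f : f \in W <-> normed_by J f by split=> /asboolP.
have subW : submod_closed W.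
  split=> [|a f g /WP fJ /WP gJ]; apply/WP => //.
  by apply: nJD => //; exact: normed_byZ.
pose WM := GRing.isSubmodClosed.Build R (dual V) W subW.
pose WS : submodClosed (dual V) := HB.pack W WM.
exists WS; split; [|split].
- rewrite (_ : [set` WS] = normed_by J); first exact: normed_by_closed.
  by apply/seteqP; split=> f /WP.
- move=> f; have [h hJ fh] := decJ f.
  by exists (f - h), h; split; rewrite ?subrK //; apply/WP.
- move=> f /annihilatorP fJ /WP fW.
  by apply: (normed_by_inj b2J) => // x /fJ.
- move=> u w uJ /WP wJ.
  by rewrite addrC (normD_normed_by b2J) // addrC.
Qed.

End M_ideal_ball.

(** The value 1 differs from the default 0 of [sup] on unbounded sets, so [f] is bounded and the
    usual scaling argument applies. *)
Lemma opnorm1_le (R : realType) (V W : normedModType R) (f : {linear V -> W}) :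
  opnorm f = 1 -> forall x, `|f x| <= `|x|.
Proof.
move=> f1 x; have [->|x0] := eqVneq x 0; first by rewrite linear0 !normr0.
have nx : 0 < `|x| by rewrite normr_gt0.
have [[_ ub]|/sup_out] := pselect
    (has_sup [set `|f x| | x in [set x : V | `|x| <= 1]]); last first.
  by rewrite -/(opnorm f) f1 => /eqP; rewrite oner_eq0.
have : `|f (`|x|^-1 *: x)| <= opnorm f.
  apply: ub_le_sup => //; exists (`|x|^-1 *: x) => //=.
  by rewrite normrZ normfV normr_id mulVf // gt_eqF.
by rewrite f1 linearZ normrZ normfV normr_id ler_pdivrMl // mulr1.
Qed.

(** * Transfer of the ball property through the norm-one projections *)

Section locally_constrained_ball.
Context {R : realType} {X : normedModType R}.
Variables Y Z1 : submodClosed X.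

Lemma linspanP (A : set X) x : A x -> x \in linspan A.
Proof. by move=> Ax; rewrite inE /= => S; apply. Qed.

Lemma locally_constrained_ball_property n :
  locally_constrained (capS Z1 Y) Z1 Y ->
  ball_property n Z1 -> ball_property n (inside Y (capS Z1 Y)).
Proof.
move=> hloc bZ x y e x1 yJ y1 e0.
have [||w wZ xyw] := bZ (subsp_val x) (fun i => subsp_val (y i)) e x1 _ _ e0.
- by move=> i; have /andP[] := yJ i.
- by move=> i; exact: y1.
have [P [Q [_ projQ _ Q1 PQ]]] := hloc w wZ.
pose D := linspan (w |` [set` Y]).
have wD : w \in D by apply: linspanP; left.
have wP : w \in linspan (w |` [set` capS Z1 Y]) by apply: linspanP; left.
have YD (u : subsp Y) : subsp_val u \in D.
  by apply: linspanP; right; exact: subsp_valP.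
pose q := Q (Subsp wD).
have qZ : subsp_val q \in capS Z1 Y.
  by rewrite -(PQ (Subsp wP) (Subsp wD)) //; exact: subsp_valP.
exists q => // i.
(* [Q] fixes [x + y i], which lies in [Y], so the new distance is the norm of an image under a
   contraction. *)
have -> : x + y i - q = Q (Subsp (YD (x + y i)) - Subsp wD).
  by rewrite linearB /= (projQ (Subsp (YD (x + y i))) (x + y i)).
apply: le_trans (opnorm1_le Q1 _) _; exact: (xyw i).
Qed.

Lemma closed_inside (S : submodClosed X) :
  closed [set` S] -> closed [set` inside Y S].
Proof.
move=> cS y cly; apply: cS => B /nbhs_ballP[e e0 yB].
have [|u [uS yu]] := cly (ball y e); first exact: nbhsx_ballx.
exists (subsp_val u); split=> //; apply: yB.
by move: yu; rewrite -!ball_normE.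
Qed.

End locally_constrained_ball.

Theorem theorem2p7 (R : realType) (X : completeNormedModType R)
    (Y Z1 : submodClosed X) (hY : closed [set` Y]) (hZ1 : closed [set` Z1])
    (hloc : locally_constrained (capS Z1 Y) Z1 Y) :
  (M_ideal Z1 -> M_ideal (inside Y (capS Z1 Y))) /\
  (semi_M_ideal Z1 -> semi_M_ideal (inside Y (capS Z1 Y))).
Proof.
have cZ2 : closed [set` inside Y (capS Z1 Y)].
  apply: closed_inside; rewrite (_ : [set` _] = [set` Z1] `&` [set` Y]).
    exact: closedI.
  by apply/seteqP; split=> x /= => [/andP[]|[xZ xY]] //; apply/andP.
(* An M-ideal has the property for every number of balls; three are what the converse takes. *)
split=> [/M_ideal_ball_property-/(_ 3)|/semi_M_ideal_ball_property] bZ.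
  apply: ball_property_M_ideal => //.
  exact: locally_constrained_ball_property.
apply: ball_property_semi_M_ideal => //.
exact: locally_constrained_ball_property.
Qed.
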